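(* Let $\lambda>0$, let $K\subset\mathbb{R}^n\times\mathbb{R}^m$ be a closed convex set, let $f=g-h$ with $g,h$ finite convex functions on $\mathbb{R}^n\times\mathbb{R}^m$, and let $\{r_\theta\}_{\theta>0}$ be an admissible family of approximations of the step function (as defined in the context). Let $\mathcal{L}$ be the set of points $(x^*,y^* )\in K$ for which there exists $(\overline{x}^*,\overline{y}^* )\in\partial f(x^*,y^* )$ such that $$\langle\overline{x}^*,x-x^*\rangle+\langle\overline{y}^*,y-y^*\rangle\ge0\quad\forall(x,y)\in K(x^* ),$$ where $K(x^* )=\{(x,y)\in K: x_i=0\ \forall i\notin \mathrm{supp}(x^* )\}$. For $\theta>0$ let $\mathcal{L}_\theta$ be the set of points $(x^*,y^* )\in K$ for which there exist $(\overline{x}^*,\overline{y}^* )\in\partial f(x^*,y^* )$ and $\overline{z}^*\in\mathbb{R}^n$ with $\overline{z}^*_i\in\lambda\,\partial r_\theta(x^*_i)$ for $i=1,\dots,n$, such that $$\langle\overline{x}^*,x-x^*\rangle+\langle\overline{y}^*,y-y^*\rangle+\langle\overline{z}^*,x-x^*\rangle\ge0\quad\forall(x,y)\in K.$$ Then: (i) Let $\{\theta_k\}$ be a sequence of positive numbers with $\theta_k\to+\infty$ and let $\{(x^k,y^k)\}$ be a sequence such that $(x^k,y^k)\in\mathcal{L}_{\theta_k}$ for every $k$. If $(x^k,y^k)\to(x^*,y^* )$, then $(x^*,y^* )\in\mathcal{L}$. (ii) If $K$ is compact, then for every $\epsilon>0$ there is $\theta(\epsilon)>0$ such that $\mathcal{L}_\theta\subset\mathcal{L}+B(0,\epsilon)$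 for all $\theta\ge\theta(\epsilon)$. (iii) If there is a finite set $\mathcal{S}\subset\mathbb{R}^n\times\mathbb{R}^m$ such that $\mathcal{L}_\theta\cap\mathcal{S}\ne\emptyset$ for all $\theta>0$, then there exists $\theta_0\ge0$ such that $\mathcal{L}_\theta\cap\mathcal{S}\subset\mathcal{L}$ for all $\theta>0$ with $\theta\ge\theta_0$.
   Context: $\mathrm{supp}(x)=\{i:x_i\ne0\}$. $B(0,\epsilon)$ is the open Euclidean ball of radius $\epsilon$ centered at $0$. For $f=g-h$ with the fixed finite convex functions $g,h$, $\partial f(x,y):=\partial g(x,y)-\partial h(x,y)=\{u-v:u\in\partial g(x,y),\,v\in\partial h(x,y)\}$, where $\partial$ of a convex function is its convex subdifferential. The function $s:\mathbb{R}\to\mathbb{R}$ is $s(t)=1$ if $t\ne0$ and $s(0)=0$. A family $\{r_\theta\}_{\theta>0}$ of functions $\mathbb{R}\to\mathbb{R}$ is called admissible if: (1) $\lim_{\theta\to+\infty}r_\theta(t)=s(t)$ for all $t\in\mathbb{R}$; (2) for every $\theta>0$, $r_\theta$ is even, i.e. $r_\theta(t)=r_\theta(|t|)$, and increasing (meaning nondecreasing) on $[0,+\infty)$; (3) for every $\theta>0$, $r_\theta=\varphi_\theta-\psi_\theta$ with given finite convex functions $\varphi_\theta,\psi_\theta$ on $\mathbb{R}$; write $\partial r_\theta(t):=\{u-v:u\in\partial\varphi_\theta(t),\,v\in\partial\psi_\theta(t)\}$; (4) $t\mu\ge0$ for all $\theta>0$, $t\in\mathbb{R}$, $\mu\in\partial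 r_\theta(t)$; (5) for any $a\le b$ with $0\notin[a,b]$, $\lim_{\theta\to+\infty}\sup\{|z|:z\in\partial r_\theta(t),\,t\in[a,b]\}=0$. *)

(* Defs.v *)
(* MathComp-Analysis *)
From HB Require Import structures.
From mathcomp Require Import all_boot all_order all_algebra.
From mathcomp Require Import all_classical all_reals all_analysis.

Set Implicit Arguments.
Unset Strict Implicit.
Unset Printing Implicit Defensive.

Import Order.TTheory GRing.Theory Num.Theory.
Import numFieldNormedType.Exports.

Local Open Scope classical_set_scope.
Local Open Scope ring_scope.

Definition dotv (R : realType) (n : nat) (u v : 'rV[R]_n) : R :=
  \sum_(i < n) u ord0 i * v ord0 i.

Definition dotp (R : realType) (n m : nat) (p q : 'rV[R]_n * 'rV[R]_m) : R :=
  dotv p.1 q.1 + dotv p.2 q.2.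

(* The library norm on row vectors and on products is the maximum norm (which
   induces the same topology), hence this separate Euclidean ball at 0. *)
Definition euclidean_ball0 (R : realType) (n m : nat) (eps : R) :
    set ('rV[R]_n * 'rV[R]_m) :=
  [set p | Num.sqrt (dotp p p) < eps].

(* [dot] is the inner product of the space: [dotp] on R^n x R^m, [*%R] on R. *)
Definition subdifferential (R : realType) (E : lmodType R) (dot : E -> E -> R)
    (f : E -> R) (x : E) : set E :=
  [set u | forall z, f x + dot u (z - x) <= f z].

Definition dc_decomposition (R : realType) (E : lmodType R)
    (f g h : E -> R) : Prop :=
  [/\ @convex_function R E setT g, @convex_function R E setT h
    & forall x, f x = g x - h x].

(* The set attached to f = g - h; it depends on the decomposition (g, h) and
   not only on f. *)
Definition dc_subdifferential (R : realType) (E : lmodType R)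
    (dot : E -> E -> R) (g h : E -> R) (x : E) : set E :=
  [set u - v | u in subdifferential dot g x & v in subdifferential dot h x].

Definition step (R : realType) (t : R) : R := if t == 0 then 0 else 1.

(* The supremum in the last clause is taken in the extended reals, where the
   supremum of an unbounded set is +oo (it would be 0 with the real-valued
   [sup]). *)
Definition admissible (R : realType) (r phi psi : R -> R -> R) : Prop :=
  let dr theta (t : R) : set R :=
    @dc_subdifferential R R^o *%R (phi theta) (psi theta) t in
  [/\ forall t : R, r theta t @[theta --> +oo] --> step t,
      forall theta : R, 0 < theta ->
        (forall t : R, r theta t = r theta `|t|) /\
        (forall t1 t2 : R, 0 <= t1 -> t1 <= t2 -> r theta t1 <= r theta t2),
      forall theta : R, 0 < theta ->
        @dc_decomposition R R^o (r theta) (phi theta) (psi theta),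
      forall theta t mu : R, 0 < theta -> dr theta t mu -> 0 <= t * mu
    & forall a b : R, a <= b -> 0 \notin `[a, b] ->
        ereal_sup [set `|z|%:E | z in
          [set z | exists2 t, t \in `[a, b] & dr theta t z]]
          @[theta --> +oo] --> 0%E].

Definition supp (R : realType) (n : nat) (x : 'rV[R]_n) : set 'I_n :=
  [set i | x ord0 i != 0].

Definition restrict_supp (R : realType) (n m : nat)
    (K : set ('rV[R]_n * 'rV[R]_m)) (xs : 'rV[R]_n) :
    set ('rV[R]_n * 'rV[R]_m) :=
  [set p | K p /\ forall i, ~ supp xs i -> p.1 ord0 i = 0].

(* The set written L. *)
Definition crit (R : realType) (n m : nat) (K : set ('rV[R]_n * 'rV[R]_m))
    (g h : 'rV[R]_n * 'rV[R]_m -> R) : set ('rV[R]_n * 'rV[R]_m) :=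
  [set p | K p /\
    exists2 w, dc_subdifferential (@dotp R n m) g h p w
      & forall q, restrict_supp K p.1 q ->
          0 <= dotv w.1 (q.1 - p.1) + dotv w.2 (q.2 - p.2)].

(* The set written L_theta. *)
Definition crit_approx (R : realType) (n m : nat) (lambda : R)
    (K : set ('rV[R]_n * 'rV[R]_m)) (g h : 'rV[R]_n * 'rV[R]_m -> R)
    (phi psi : R -> R -> R) (theta : R) : set ('rV[R]_n * 'rV[R]_m) :=
  [set p | K p /\
    exists w : 'rV[R]_n * 'rV[R]_m, exists z : 'rV[R]_n,
      [/\ dc_subdifferential (@dotp R n m) g h p w,
          forall i, [set lambda * mu | mu in @dc_subdifferential R R^o *%R
                      (phi theta) (psi theta) (p.1 ord0 i)] (z ord0 i)
        & forall q, K q ->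
            0 <= dotv w.1 (q.1 - p.1) + dotv w.2 (q.2 - p.2)
                 + dotv z (q.1 - p.1)]].

(* Main.v *)
(** Along an ultrafilter, the subgradients of [g] and [h] at the approximate
critical points converge, because subdifferentials of a finite convex function
are locally contained in a compact set, and the limits are subgradients by
continuity of [g] and [h]. Test the variational inequality at a point of [K]
supported in the support of the limit: the coordinates of the penalty term in
that support vanish in the limit by clause (5) of admissibility, and the other
ones are [- lambda mu x_i <= 0] by clause (4). This limit theorem holds for an
arbitrary proper filter, which covers the three claims: (ii) and (iii) follow
from it along the trace of [+oo] on the set of parameters [theta] that violate
the conclusion. *)
Require Import Defs.
From mathcomp Require Import all_boot all_order all_algebra.
From mathcomp Require Import all_classical all_reals all_analysis.
From mathcomp Require Import lra.

Set Implicit Arguments.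
Unset Strict Implicit.
Unset Printing Implicit Defensive.

Import Order.TTheory GRing.Theory Num.Theory.
Import numFieldNormedType.Exports.
Local Open Scope classical_set_scope.
Local Open Scope ring_scope.

(** * Ultrafilters and traces of filters *)

Lemma ultrafilter_fmap (T U : Type) (q : T -> U) (F : set_system T) :
  UltraFilter F -> UltraFilter (q @ F).
Proof.
move=> FU; split=> [|G GF qFG]; first exact: fmap_proper_filter.
apply/seteqP; split=> [A GA|]; last exact: qFG.
have [//|FnA] := in_ultra_setVsetC (q @^-1` A) FU.
have /(filterI GA) : G (~` A) by exact: qFG.
by rewrite setICr => /filter_not_empty.
Qed.

(** Plays the role of the extraction of a convergent subsequence: once an ultrafilter is fixed,
    every family that is eventually in a compact set converges along it. *)
Lemma compact_ultra_cvg (T : Type) (U : topologicalType) (q : T -> U)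
    (A : set U) (F : set_system T) :
  UltraFilter F -> compact A -> (\forall t \near F, A (q t)) ->
  exists2 a, A a & q @ F --> a.
Proof.
rewrite compact_ultra => FU /(_ (q @ F)) cA FA.
by have [] := cA (ultrafilter_fmap q FU) FA => a [Aa qa]; exists a.
Qed.

(** Serves proofs by contradiction: when counterexamples keep occurring along [F], limits can be
    taken along the trace of [F] on them. *)
Lemma within_proper_filter (T : Type) (F : set_system T) (D : set T) :
  Filter F -> ~ (\forall t \near F, ~ D t) -> ProperFilter (within D F).
Proof.
by move=> FF nFnD; split=> [FnD|]; [exact: nFnD|exact: within_filter].
Qed.

(** * Convexity inequalities and upper bounds on boxes *)

Section convex_lmod.
Context {R : realType} {E : lmodType R} (g : E -> R).
Hypothesis g_cvx : @convex_function R E setT g.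

Lemma convex_functionE (t : R) (x y : E) : 0 <= t <= 1 ->
  g (t *: x + (1 - t) *: y) <= t * g x + (1 - t) * g y.
Proof.
move=> t01.
exact: (g_cvx (Itv01 (andP t01).1 (andP t01).2) (in_setT x) (in_setT y)).
Qed.

(** Used to turn an upper bound at the reflected point [p - d] into a lower bound at [p + d]. *)
Lemma convex_midpoint (p d : E) : 2 * g p <= g (p + d) + g (p - d).
Proof.
have := @convex_functionE 2^-1 (p + d) (p - d) ltac:(lra).
have -> : 1 - 2^-1 = 2^-1 :> R by lra.
rewrite -scalerDr addrACA subrr addr0 -mulr2n -(scaler_nat 2 p) scalerA.
rewrite mulVf ?pnatr_eq0// scale1r; lra.
Qed.

Lemma convex_segment_le (p d : E) (B c M : R) : `|c| <= B ->
  g (p + B *: d) <= M -> g (p - B *: d) <= M -> g (p + c *: d) <= M.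
Proof.
rewrite ler_norml => /andP[cB1 cB2] gB1 gB2.
have [B0|B0] := leP B 0.
  by have -> : c = B by lra.
(* The weight solves [t * B - (1 - t) * B = c]. *)
pose t := (1 + c / B) / 2.
have cE : c = c / B * B by rewrite mulfVK// gt_eqF.
have ct : -1 <= c / B <= 1.
  by rewrite ler_pdivlMr// mulN1r cB1 ler_pdivrMr// mul1r.
have t01 : 0 <= t <= 1 by rewrite /t; lra.
have -> : p + c *: d = t *: (p + B *: d) + (1 - t) *: (p - B *: d).
  rewrite !scalerDr scalerN addrACA -scalerDl addrC !scalerA -scalerBl.
  rewrite addrC (addrC t) subrK scale1r; congr (_ + _ *: _).
  rewrite /t {1}cE; lra.
apply: (le_trans (convex_functionE _ _ t01)).
have : t * g (p + B *: d) <= t * M by rewrite ler_wpM2l//; lra.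
have : (1 - t) * g (p - B *: d) <= (1 - t) * M by rewrite ler_wpM2l//; lra.
lra.
Qed.

(** A convex function on a box is bounded by its values at the vertices: by [convex_segment_le],
    each coefficient in turn may be moved to [B] or [- B], which shifts the base point in the
    induction. *)
Lemma convex_bounded_above_sum (I : Type) (s : seq I) (e : I -> E)
    (p : E) (B : R) :
  exists M, forall c : I -> R, (forall i, `|c i| <= B) ->
    g (p + \sum_(i <- s) c i *: e i) <= M.
Proof.
elim: s p B => [|i s IHs] p B.
  by exists (g p) => c _; rewrite big_nil addr0.
have [M1 M1P] := IHs (p + B *: e i) B.
have [M2 M2P] := IHs (p - B *: e i) B.
exists (Num.max M1 M2) => c cB; rewrite big_cons addrA addrAC.
apply: (@convex_segment_le _ _ B) => //; rewrite addrAC le_max.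
  by rewrite M1P.
by rewrite M2P// orbT.
Qed.

End convex_lmod.

(** * Continuity from a local upper bound *)

Section convex_normed.
Context {R : realType} {V : normedModType R} (g : V -> R).
Hypothesis g_cvx : @convex_function R V setT g.

Lemma convex_bounded_above_continuous (p : V) (M : R) :
  (forall d, `|d| <= 1 -> g (p + d) <= M) -> {for p, continuous g}.
Proof.
move=> gM.
have gpM : g p <= M by rewrite -[p]addr0 gM// normr0.
have up d : `|d| <= 1 -> g (p + d) <= g p + `|d| * (M - g p).
  move=> d1; have [->|d0] := eqVneq d 0.
    by rewrite addr0 normr0 mul0r addr0.
  have nd : 0 < `|d| by rewrite normr_gt0.
  (* The point [p + d] lies on the segment from [p] to the point of the unit sphere around [p] in
     the direction [d]. *)
  have -> : p + d = `|d| *: (p + `|d|^-1 *: d) + (1 - `|d|) *: p.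
    rewrite scalerDr scalerA mulfV ?gt_eqF// scale1r addrAC -scalerDl.
    by rewrite addrC (addrC `|d|) subrK scale1r addrC.
  have d01 : 0 <= `|d| <= 1 by rewrite normr_ge0.
  apply: (le_trans (convex_functionE g_cvx _ _ d01)).
  have : `|d| * g (p + `|d|^-1 *: d) <= `|d| * M.
    rewrite ler_wpM2l// gM// normrZ normfV normr_id mulVf// gt_eqF//.
  lra.
have lip d : `|d| <= 1 -> `|g p - g (p + d)| <= `|d| * (M - g p).
  move=> d1; rewrite ler_norml; apply/andP; split; have := up d d1; first lra.
  have := up (- d); rewrite normrN => /(_ d1).
  have := convex_midpoint g_cvx p d; lra.
apply/(@cvgrPdist_le _ R^o) => /= e e0.
(* The added 1 keeps the divisor positive when [M = g p]. *)
have Mp : 0 < M - g p + 1 by lra.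
near=> q.
have -> : q = p + (q - p) by rewrite addrC subrK.
have qp1 : `|q - p| <= 1.
  rewrite distrC; near: q; apply: cvgr_dist_le => //; exact: cvg_id.
have qpe : `|q - p| <= e / (M - g p + 1).
  rewrite distrC; near: q; apply: cvgr_dist_le; [exact: cvg_id|exact: divr_gt0].
apply: (le_trans (lip _ qp1)).
move: qpe; rewrite ler_pdivlMr//; have := normr_ge0 (q - p); lra.
Unshelve. all: by end_near. Qed.

End convex_normed.

(** * Coordinates and inner products *)

Lemma ler_norm_coord (R : realType) (n : nat) (x : 'rV[R]_n) (i : 'I_n) :
  `|x ord0 i| <= `|x|.
Proof.
rewrite [leRHS]mx_normrE.
exact: (@le_bigmax _ _ _ 0 (fun ij : 'I_1 * 'I_n => `|x ij.1 ij.2|) (ord0, i)).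
Qed.

Lemma norm_delta_mx_le1 (R : realType) (n : nat) (i : 'I_n) :
  `|delta_mx ord0 i : 'rV[R]_n| <= 1.
Proof.
rewrite [leLHS]mx_normrE; apply/bigmax_leP; split=> // -[k j] _ /=.
by rewrite mxE normr_nat; case: (_ && _).
Qed.

Section dot_product.
Context {R : realType}.

Lemma dotv_delta (n : nat) (u : 'rV[R]_n) (i : 'I_n) :
  dotv u (delta_mx ord0 i) = u ord0 i.
Proof.
rewrite /dotv (bigD1 i)//= mxE !eqxx mulr1 big1 ?addr0// => j ji.
by rewrite mxE (negbTE ji) mulr0.
Qed.

Lemma dotvN (n : nat) (u v : 'rV[R]_n) : dotv u (- v) = - dotv u v.
Proof. by rewrite -sumrN; apply: eq_bigr => i _; rewrite mxE mulrN. Qed.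

Lemma dotv0 (n : nat) (u : 'rV[R]_n) : dotv u 0 = 0.
Proof. by rewrite /dotv big1// => i _; rewrite mxE mulr0. Qed.

Lemma dotpN (n m : nat) (u v : 'rV[R]_n * 'rV[R]_m) :
  dotp u (- v) = - dotp u v.
Proof. by rewrite /dotp !dotvN opprD. Qed.

Lemma cvg_dotv (T : Type) (F : set_system T) (FF : Filter F) (n : nat)
    (a b : T -> 'rV[R]_n) (u v : 'rV[R]_n) :
  a @ F --> u -> b @ F --> v -> dotv (a t) (b t) @[t --> F] --> dotv u v.
Proof.
move=> au bv; apply: cvg_big => [|i _]; first exact: add_continuous.
by apply: cvgM; [exact: (cvg_comp _ _ au (@coord_continuous _ _ _ _ _ _))|
  exact: (cvg_comp _ _ bv (@coord_continuous _ _ _ _ _ _))].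
Qed.

Lemma cvg_dotp (T : Type) (F : set_system T) (FF : Filter F) (n m : nat)
    (a b : T -> 'rV[R]_n * 'rV[R]_m) (u v : 'rV[R]_n * 'rV[R]_m) :
  a @ F --> u -> b @ F --> v -> dotp (a t) (b t) @[t --> F] --> dotp u v.
Proof.
move=> au bv; apply: cvgD; apply: cvg_dotv.
- exact: cvg_comp au cvg_fst.
- exact: cvg_comp bv cvg_fst.
- exact: cvg_comp au cvg_snd.
- exact: cvg_comp bv cvg_snd.
Qed.

End dot_product.

(** * Convex functions and subdifferentials on the product space *)

Section convex_rV_prod.
Context {R : realType} {n m : nat}.
Notation V := ('rV[R]_n * 'rV[R]_m)%type.
Variable g : V -> R.
Hypothesis g_cvx : @convex_function R V setT g.

(** For the maximum norm, a ball is a box in the canonical basis [e], so the bound on boxes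
    applies. *)
Lemma convex_bounded_above_ball (p : V) (B : R) :
  exists M, forall d : V, `|d| <= B -> g (p + d) <= M.
Proof.
pose e (k : 'I_n + 'I_m) : V :=
  match k with
  | inl i => (delta_mx ord0 i, 0)
  | inr j => (0, delta_mx ord0 j)
  end.
have [M gM] := convex_bounded_above_sum g_cvx (index_enum _) e p B.
exists M => d dB.
pose c k := match k with inl i => d.1 ord0 i | inr j => d.2 ord0 j end.
have -> : d = \sum_k c k *: e k.
  rewrite big_sumType/= [LHS](_ : _ = (d.1, 0) + (0, d.2)); last first.
    by case: (d) => d1 d2; congr pair; rewrite /= ?addr0 ?add0r.
  congr (_ + _).
    rewrite {1}(row_sum_delta d.1).
    rewrite (big_morph (fun v => (v, 0 : 'rV[R]_m)) (id1 := 0) (op1 := +%R))//.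
      by apply: eq_bigr => i _; congr pair; rewrite /= scaler0.
    by move=> x y; congr pair; rewrite /= addr0.
  rewrite {1}(row_sum_delta d.2).
  rewrite (big_morph (fun v => (0 : 'rV[R]_n, v)) (id1 := 0) (op1 := +%R))//.
    by apply: eq_bigr => i _; congr pair; rewrite /= scaler0.
  by move=> x y; congr pair; rewrite /= addr0.
apply: gM => k; apply: le_trans dB; rewrite prod_normE le_max.
by case: k => k /=; rewrite ler_norm_coord ?orbT.
Qed.

Lemma convex_continuous : continuous g.
Proof.
by move=> p; have [M] := convex_bounded_above_ball p 1;
  exact: convex_bounded_above_continuous.
Qed.

(** Testing the subgradient inequality at [q + e] and [q - e], with [e] a basis vector, bounds each
    coordinate of a subgradient at [q]. *)
Lemma subdifferential_locally_bounded (p : V) :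
  exists2 A : set V, compact A &
    \forall q \near p, subdifferential (@dotp R n m) g q `<=` A.
Proof.
(* Radius 2 covers [q + e] when both [q - p] and [e] have norm at most 1. *)
have [M gM] := convex_bounded_above_ball p 2.
(* This is the upper bound [M] of [g (q + e)] minus the lower bound [2 * g p - M] of [g q], the
   latter obtained by reflection through [p]. *)
pose C : R := 2 * M - 2 * g p.
pose box k := [set v : 'rV[R]_k | forall i, `[- C, C]%classic (v ord0 i)].
have cbox k : compact (box k).
  by apply: (@rV_compact R k (fun=> `[- C, C]%classic)) => _;
    exact: segment_compact.
exists (box n `*` box m); first exact: compact_setX.
near=> q => u ug.
have qp1 : `|q - p| <= 1.
  by rewrite distrC; near: q; apply: cvgr_dist_le => //; exact: cvg_id.
have qM e : `|e| <= 1 -> g (q + e) <= M.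
  move=> e1; have -> : q + e = p + (q - p + e) by rewrite addrA (addrC p) subrK.
  by apply: gM; rewrite (le_trans (ler_normD _ _))//; lra.
have qm : 2 * g p - M <= g q.
  have := convex_midpoint g_cvx p (q - p); rewrite (addrC p) subrK.
  have /gM : `|- (q - p)| <= 2 by rewrite normrN; lra.
  lra.
have ue e : `|e| <= 1 -> - C <= dotp u e <= C.
  move=> e1; have := ug (q + e); have := ug (q - e).
  rewrite (addrC q) addrK (addrC q) addrK dotpN.
  have := qM (- e); rewrite normrN (addrC q) => /(_ e1).
  have := qM e e1; rewrite (addrC q) /C; lra.
split=> i /=; rewrite in_itv/=.
- have := ue (delta_mx ord0 i, 0); rewrite /dotp/= dotv_delta dotv0 addr0.
  by apply; rewrite prod_normE/= normr0 ge_max norm_delta_mx_le1 ler01.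
- have := ue (0, delta_mx ord0 i); rewrite /dotp/= dotv_delta dotv0 add0r.
  by apply; rewrite prod_normE/= normr0 ge_max norm_delta_mx_le1 ler01.
Unshelve. all: by end_near. Qed.

Lemma subdifferential_closed_graph (T : Type) (F : set_system T)
    (FF : ProperFilter F) (q u : T -> V) (p v : V) :
  q @ F --> p -> u @ F --> v ->
  (\forall t \near F, subdifferential (@dotp R n m) g (q t) (u t)) ->
  subdifferential (@dotp R n m) g p v.
Proof.
move=> qp uv qu z.
have := @cvgr_to_le T F FF R (fun t => g (q t) + dotp (u t) (z - q t)); apply.
  apply: cvgD; first exact: (cvg_comp _ _ qp (@convex_continuous p)).
  by apply: cvg_dotp => //; apply: cvgB => //; exact: cvg_cst.
by near=> t; have : subdifferential (@dotp R n m) g (q t) (u t) by near: t.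
Unshelve. all: by end_near. Qed.

End convex_rV_prod.

(** * Limits of approximate critical points *)

Section limit_of_critical_points.
Context {R : realType} (r phi psi : R -> R -> R).
Hypothesis r_adm : admissible r phi psi.
Notation dr theta := (@dc_subdifferential R R^o *%R (phi theta) (psi theta)).

(** The interval of radius [|x0| / 2] around [x0] avoids 0 and eventually contains [x t], so clause
    (5) on it bounds [mu t]. *)
Lemma admissible_subdifferential_cvg0 (T : Type) (F : set_system T)
    (FF : ProperFilter F) (theta x mu : T -> R) (x0 : R) :
  x0 != 0 -> theta @ F --> +oo -> x @ F --> x0 ->
  (\forall t \near F, dr (theta t) (x t) (mu t)) -> mu @ F --> 0.
Proof.
move=> x00 thetay xx0 drmu.
pose d := `|x0| / 2.
have d0 : 0 < d by rewrite divr_gt0// normr_gt0.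
have ab : x0 - d <= x0 + d by lra.
have ab0 : 0 \notin `[x0 - d, x0 + d].
  rewrite in_itv/= /d; apply/negP => /andP[].
  by move: x00; case: (ltrgt0P x0) => // *; lra.
have [_ _ _ _ /(_ _ _ ab ab0) sup0] := r_adm.
have {}sup0 := cvg_comp _ _ thetay sup0.
apply/cvgrPdist_le => /= e e0.
have supe : nbhs 0%E [set s : \bar R | (s <= e%:E)%E].
  by apply/nbhs_EFin; apply: filterS (lt_nbhsl e0) => s /ltW se;
    rewrite /= lee_fin.
have xd : \forall t \near F, `|x0 - x t| <= d by exact: cvgr_dist_le.
have {}supe : F _ := sup0 _ supe.
apply: filterS3 supe drmu xd => t /= + drt xt.
rewrite sub0r normrN -lee_fin; apply: le_trans.
apply: ereal_sup_ubound; exists (mu t) => //; exists (x t) => //.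
by rewrite in_itv/= -ler_distlC.
Qed.

Context {n m : nat} (K : set ('rV[R]_n * 'rV[R]_m)) (lambda : R).
Variables g h : 'rV[R]_n * 'rV[R]_m -> R.
Hypothesis lambda_gt0 : 0 < lambda.
Hypothesis K_closed : closed K.
Hypothesis g_cvx : @convex_function R ('rV[R]_n * 'rV[R]_m)%type setT g.
Hypothesis h_cvx : @convex_function R ('rV[R]_n * 'rV[R]_m)%type setT h.

Lemma crit_approx_cvg (T : Type) (F : set_system T) (FF : ProperFilter F)
    (theta : T -> R) (q : T -> 'rV[R]_n * 'rV[R]_m)
    (p : 'rV[R]_n * 'rV[R]_m) :
  theta @ F --> +oo -> q @ F --> p ->
  (\forall t \near F, crit_approx lambda K g h phi psi (theta t) (q t)) ->
  crit K g h p.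
Proof.
have [G [GU FG]] := ultraFilterLemma FF.
move=> /(cvg_trans (cvg_app theta FG)) thetay /(cvg_trans (cvg_app q FG)) qp.
move=> /FG {F FF FG} critq.
(* [c t] collects the subgradients of [g] and [h] and the vector of the [mu], recovered from [z] by
   dividing by [lambda]; where [q t] is not critical it is 0. *)
have /choice[c cP] : forall t, exists c : ('rV[R]_n * 'rV[R]_m) *
      ('rV[R]_n * 'rV[R]_m) * 'rV[R]_n,
    crit_approx lambda K g h phi psi (theta t) (q t) ->
    [/\ K (q t), subdifferential (@dotp R n m) g (q t) c.1.1,
      subdifferential (@dotp R n m) h (q t) c.1.2,
      forall i, dr (theta t) ((q t).1 ord0 i) (c.2 ord0 i) &
      forall y, K y -> 0 <= dotp (c.1.1 - c.1.2) (y - q t) +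
        dotv (lambda *: c.2) (y.1 - (q t).1)].
  move=> t; have [|ncrit] := pselect
      (crit_approx lambda K g h phi psi (theta t) (q t)); last first.
    by exists (0, 0, 0).
  move=> [Kqt [w [z [[u gu [v hv uvw]] zP wzP]]]].
  have lz i : (lambda^-1 *: z) ord0 i = lambda^-1 * z ord0 i by rewrite mxE.
  exists (u, v, lambda^-1 *: z) => _; split=> //= [i|y Ky].
    by rewrite lz; have [mu muP <-] := zP i; rewrite mulKf// gt_eqF.
  by rewrite scalerA mulfV ?gt_eqF// scale1r uvw; exact: wzP.
have {}critq : \forall t \near G, [/\ K (q t),
      subdifferential (@dotp R n m) g (q t) (c t).1.1,
      subdifferential (@dotp R n m) h (q t) (c t).1.2,
      forall i, dr (theta t) ((q t).1 ord0 i) ((c t).2 ord0 i) &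
      forall y, K y -> 0 <= dotp ((c t).1.1 - (c t).1.2) (y - q t) +
        dotv (lambda *: (c t).2) (y.1 - (q t).1)].
  by apply: filterS critq => t /cP.
have [A cA gA] := subdifferential_locally_bounded g_cvx p.
have [B cB hB] := subdifferential_locally_bounded h_cvx p.
have [|u _ cu] := compact_ultra_cvg (q := fun t => (c t).1.1) GU cA.
  have gq : G _ := qp _ gA.
  by apply: filterS2 gq critq => t sub [_ gu _ _ _]; exact: sub.
have [|v _ cv] := compact_ultra_cvg (q := fun t => (c t).1.2) GU cB.
  have hq : G _ := qp _ hB.
  by apply: filterS2 hq critq => t sub [_ _ hv _ _]; exact: sub.
split.
  apply: (closed_cvg K K_closed _ _ qp).
  by apply: filterS critq => t [].
exists (u - v).
  exists u; [|exists v => //].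
    apply: (subdifferential_closed_graph g_cvx _ qp cu).
    by apply: filterS critq => t [].
  apply: (subdifferential_closed_graph h_cvx _ qp cv).
  by apply: filterS critq => t [].
move=> y [Ky ysupp].
have qpi i : (q t).1 ord0 i @[t --> G] --> p.1 ord0 i.
  have q1 : (q t).1 @[t --> G] --> p.1 by exact: cvg_comp qp cvg_fst.
  exact: (cvg_comp _ _ q1 (@coord_continuous _ _ _ _ _ _)).
(* The penalty terms with those outside the support of [p.1] replaced by 0: there [mu] may be
   unbounded, and only the sign of the term is available. *)
pose b t i := if p.1 ord0 i == 0 then 0 else
  lambda * (c t).2 ord0 i * (y.1 ord0 i - (q t).1 ord0 i).
have b0 : \sum_(i < n) b t i @[t --> G] --> \sum_(i < n) (0 : R).
  apply: cvg_big => [|i _]; first exact: add_continuous.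
  rewrite /b; case: eqVneq => [_|pi0]; first exact: cvg_cst.
  rewrite -(mul0r (y.1 ord0 i - p.1 ord0 i)) -{1}(mulr0 lambda).
  apply: cvgM; last by apply: cvgB => //; exact: cvg_cst.
  apply: cvgM; first exact: cvg_cst.
  apply: (admissible_subdifferential_cvg0 _ pi0 thetay (qpi i)).
  by apply: filterS critq => t [].
have lim : dotp ((c t).1.1 - (c t).1.2) (y - q t) + \sum_(i < n) b t i
    @[t --> G] --> dotp (u - v) (y - p) + \sum_(i < n) 0.
  apply: cvgD => //; apply: cvg_dotp; first exact: cvgB.
  by apply: cvgB => //; exact: cvg_cst.
rewrite big1// addr0 in lim.
apply: (cvgr_to_ge lim).
(* Clause (4) is available for positive parameters only. *)
have theta_gt0 : G _ := thetay _ (nbhs_pinfty_gt (num_real 0)).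
apply: filterS2 theta_gt0 critq => t /= theta_gt0 [_ _ _ drq cq].
apply: (le_trans (cq y Ky)); rewrite lerD2l; apply: ler_sum => i _.
rewrite !mxE /b; case: eqVneq => // pi0.
(* Outside the support [y] vanishes, so the true term is [- lambda * mu * x_i], with [x_i] the
   coordinate of [q t], and clause (4) makes it at most 0. *)
rewrite (ysupp i) ?sub0r; last by rewrite /supp/= pi0 eqxx.
have [_ _ _ + _] := r_adm.
move=> /(_ (theta t) ((q t).1 ord0 i) ((c t).2 ord0 i)) drs.
rewrite mulrN oppr_le0 -mulrA mulr_ge0//; first exact: ltW.
rewrite mulrC.
exact: drs.
Qed.

End limit_of_critical_points.

(** * Euclidean balls and the three claims *)

(** Continuity of [dotp] brings the squared Euclidean length below [eps ^+ 2], which links the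
    maximum norm topology to the Euclidean ball. *)
Lemma cvg0_euclidean_ball0 (R : realType) (n m : nat) (T : Type)
    (F : set_system T) (FF : Filter F) (b : T -> 'rV[R]_n * 'rV[R]_m)
    (eps : R) :
  0 < eps -> b @ F --> (0 : 'rV[R]_n * 'rV[R]_m) ->
  \forall t \near F, euclidean_ball0 eps (b t).
Proof.
move=> eps0 b0; have dotp0 := cvg_dotp FF b0 b0.
have eps20 : dotp (0 : 'rV[R]_n * 'rV[R]_m) 0 < eps ^+ 2.
  by rewrite /dotp !dotv0 addr0 exprn_gt0.
apply: filterS (cvgr_lt _ dotp0 _ eps20) => t beps.
rewrite /euclidean_ball0/= -[ltRHS](gtr0_norm eps0) -sqrtr_sqr.
by rewrite ltr_sqrt// exprn_gt0.
Qed.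

Theorem theorem2 (R : realType) (n m : nat) (lambda : R)
    (K : set ('rV[R]_n * 'rV[R]_m))
    (f g h : 'rV[R]_n * 'rV[R]_m -> R) (r phi psi : R -> R -> R)
    (lambda_gt0 : 0 < lambda)
    (K_closed : closed K)
    (K_convex : @convex_set R ('rV[R]_n * 'rV[R]_m)%type K)
    (f_dc : dc_decomposition f g h)
    (r_adm : admissible r phi psi) :
  let L := crit K g h in
  let Lth := crit_approx lambda K g h phi psi in
  [/\ forall (theta : nat -> R) (xy : nat -> 'rV[R]_n * 'rV[R]_m)
        (p : 'rV[R]_n * 'rV[R]_m),
        (forall k, 0 < theta k) -> theta @ \oo --> +oo ->
        (forall k, Lth (theta k) (xy k)) ->
        xy @ \oo --> p -> L p,
      compact K ->
        forall eps : R, 0 < eps -> exists2 theta_eps : R, 0 < theta_eps &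
          forall theta : R, theta_eps <= theta ->
            Lth theta `<=` [set p + b | p in L & b in euclidean_ball0 eps]
    & forall S : set ('rV[R]_n * 'rV[R]_m), finite_set S ->
        (forall theta : R, 0 < theta -> Lth theta `&` S !=set0) ->
        exists2 theta0 : R, 0 <= theta0 &
          forall theta : R, 0 < theta -> theta0 <= theta ->
            Lth theta `&` S `<=` L].
Proof.
move=> L Lth; have [g_cvx h_cvx _] := f_dc.
pose crit_lim := crit_approx_cvg r_adm lambda_gt0 K_closed g_cvx h_cvx.
have eventually_large (P : R -> Prop) : (\forall t \near +oo, P t) ->
    exists2 t0, 0 < t0 & forall t, t0 <= t -> P t.
  (* The bound [M] may be negative and is strict, hence the maximum with 0 and the added 1. *)
  move=> [M [_ MP]]; exists (Num.max M 0 + 1).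
    by rewrite ltr_wpDl// le_max lexx orbT.
  by move=> t Mt; apply: MP; apply: lt_le_trans Mt;
    rewrite ltr_pwDr// le_max lexx.
split.
- move=> theta xy p _ thetay xyL xyp.
  by apply: (crit_lim _ _ _ _ _ _ thetay xyp); exact: nearW.
- move=> K_compact eps eps0; apply: eventually_large.
  (* If bad parameters persist, points [q t] chosen for them converge in the compact [K] along an
     ultrafilter; the limit is in [L], so [q t] eventually enters the ball around it, a
     contradiction. *)
  pose bad t := exists2 q, Lth t q &
    ~ [set p + b | p in L & b in euclidean_ball0 eps] q.
  apply: contrapT => nlarge.
  have bad_proper : ProperFilter (within bad +oo).
    apply: within_proper_filter => nbad.
    apply: nlarge; apply: filterS nbad => t nbadt q Lq.
    by apply: contrapT => nq; apply: nbadt; exists q.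
  have /choice[q qP] : forall t, exists q, bad t -> Lth t q /\
      ~ [set p + b | p in L & b in euclidean_ball0 eps] q.
    move=> t; have [[q Lq nq]|nbad] := pselect (bad t); first by exists q.
    by exists 0.
  have [G [GU badG]] := ultraFilterLemma bad_proper.
  have Gy : G --> +oo by apply: cvg_trans badG _; exact: cvg_within.
  have GP : \forall t \near G, Lth t (q t) /\
      ~ [set p + b | p in L & b in euclidean_ball0 eps] (q t).
    by apply: badG; apply: filterS (withinT bad _) => t; exact: qP.
  have [|p _ qp] := compact_ultra_cvg (q := q) GU K_compact.
    by apply: filterS GP => t [[]].
  have Lp : L p.
    by apply: (crit_lim _ _ _ _ _ _ Gy qp); apply: filterS GP => t [].
  have qp0 : q t - p @[t --> G] --> p - p.
    by apply: cvgB => //; exact: cvg_cst.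
  rewrite subrr in qp0.
  have qball := cvg0_euclidean_ball0 (F := G) _ eps0 qp0.
  have [t [[_ nq] qt]] := filter_ex (filterI GP (qball _)).
  apply: nq; exists p => //; exists (q t - p) => //.
  by rewrite addrC subrK.
- move=> S S_fin _.
  (* For a fixed [p], the limit theorem is applied to the constant family [p] along the parameters
     with [Lth t p]; if these persist, then [L p] and the implication holds for every [t]. *)
  have Slarge p : S p -> \forall t \near +oo, Lth t p -> L p.
    move=> Sp; apply: contrapT => nlarge.
    have bad_proper : ProperFilter (within [set t | Lth t p] +oo).
      apply: within_proper_filter => nbad.
      by apply: nlarge; apply: filterS nbad => t.
    apply: nlarge; apply: nearW => t _.
    apply: (crit_lim _ (within [set t | Lth t p] +oo) _ id (fun=> p)).
    + exact: cvg_within.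
    + exact: cvg_cst.
    + exact: withinT.
  (* Finiteness of [S] makes the threshold uniform in [p]. *)
  have : \forall t \near +oo, forall p, S p -> Lth t p -> L p.
    have /finite_fsetP[X SX] := S_fin.
    have := @filter_bigI R _ X (fun p t => Lth t p -> L p) +oo _.
    rewrite SX in Slarge * => /(_ _ Slarge).
    by apply: filterS => t tX p pX; exact: tX.
  move=> /eventually_large[t0 t00 t0P]; exists t0; first exact: ltW.
  by move=> t _ t0t p [Lp Sp]; exact: t0P Lp.
Qed.
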